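(* Suppose $G$ is a finitely generated group which acts by isometries on an $\mathbb R$-tree $\Gamma$. Suppose the action is minimal and irreducible, and that the translation length of every element of $G$ is an integer. Then $\Gamma$ is a simplicial tree.
   Context: An $\mathbb R$-tree is a path-metric space (the distance between two points is the infimum of the lengths of paths joining them) in which any two points are the endpoints of a unique arc, and this arc is isometric to an interval in $\mathbb R$. The translation length of an isometry $\tau$ of $\Gamma$ is $t(\tau)=\inf\{d(x,\tau x):x\in\Gamma\}$. An isometry $\tau$ is hyperbolic if $t(\tau)>0$ and $\{x\in\Gamma:d(x,\tau x)=t(\tau)\}$ is isometric to a line, called its axis. An action of $G$ on $\Gamma$ is minimal if there is no proper subtree preserved by $G$. It is irreducible if there are two elements of $G$ which are both hyperbolic and whose axes are disjoint. *)

(* Defs.v *)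
From HB Require Import structures.
From mathcomp Require Import all_boot all_order all_algebra.
From mathcomp Require Import all_classical all_reals all_analysis.

Set Implicit Arguments.
Unset Strict Implicit.
Unset Printing Implicit Defensive.

Import Order.TTheory GRing.Theory Num.Theory.
Import numFieldTopology.Exports.

Local Open Scope classical_set_scope.
Local Open Scope ring_scope.

Section MetricTrees.
Variables (R : realType) (X : metricType R).

(* The R-tree notions are relative to a subset [Y] of [X], carrying the induced
   metric, so that a subtree is literally a subset which is itself an R-tree. *)

Definition is_path (Y : set X) (a b : R) (f : R -> X) (x y : X) : Prop :=
  [/\ a <= b, {within `[a, b], continuous f}, f @` `[a, b] `<=` Y,
      f a = x & f b = y].

(* The analogue of [variation] of numfun, for a map into a metric space. *)
Definition path_variation (a b : R) (f : R -> X) (s : seq R) : R :=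
  let F := f \o nth b (a :: s) in
  \sum_(0 <= n < size s) mdist (F n.+1) (F n).

Definition path_length (a b : R) (f : R -> X) : \bar R :=
  ereal_sup [set (path_variation a b f s)%:E | s in itv_partition a b].

Definition path_metric (Y : set X) : Prop :=
  forall x y, Y x -> Y y ->
    (mdist x y)%:E =
    ereal_inf [set l | exists a b f,
                 is_path Y a b f x y /\ l = path_length a b f].

(* The parameter interval may be reduced to a point, so that [set x] is the
   (degenerate) arc from [x] to itself. *)
Definition is_arc (Y : set X) (x y : X) (A : set X) : Prop :=
  exists a b f,
    [/\ is_path Y a b f x y, set_inj `[a, b] f & A = f @` `[a, b]].

Definition isometric_to (J : set R) (A : set X) : Prop :=
  exists f : R -> X,
    (forall s t, J s -> J t -> mdist (f s) (f t) = `|s - t|) /\ f @` J = A.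

Definition is_Rtree (Y : set X) : Prop :=
  path_metric Y /\
  forall x y, Y x -> Y y ->
    (exists! A, is_arc Y x y A) /\
    (forall A, is_arc Y x y A -> exists i : interval R, isometric_to [set` i] A).

Definition is_subtree (Y : set X) : Prop := Y !=set0 /\ is_Rtree Y.

Definition translation_length (f : X -> X) : R :=
  inf (range (fun x => mdist x (f x))).

Definition axis (f : X -> X) : set X :=
  [set x | mdist x (f x) = translation_length f].

Definition hyperbolic (f : X -> X) : Prop :=
  0 < translation_length f /\ isometric_to setT (axis f).

End MetricTrees.

Section Actions.
Variables (R : realType) (X : metricType R) (G : groupType).

Definition finitely_generated : Prop :=
  exists S : seq G, forall H : set G,
    H 1%g -> (forall g h, H g -> H h -> H (g * h)%g) ->
    (forall g, H g -> H (g^-1)%g) -> (forall g, g \in S -> H g) ->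
    H = setT.

Variable act : G -> X -> X.

Definition isometric_action : Prop :=
  [/\ forall x, act 1%g x = x,
      forall g h x, act (g * h)%g x = act g (act h x) &
      forall g x y, mdist (act g x) (act g y) = mdist x y].

Definition minimal_action : Prop :=
  forall Y : set X, is_subtree Y ->
    (forall g x, Y x -> Y (act g x)) -> Y = setT.

Definition irreducible_action : Prop :=
  exists g h, [/\ hyperbolic (act g), hyperbolic (act h) &
                  axis (act g) `&` axis (act h) = set0].

End Actions.

Section SimplicialTrees.
Variable R : realType.

Section Realization.
Variables (V : choiceType) (adj : rel V) (len : V -> V -> R).

(* In a simple graph every edge yields simple cycles of size 2, and these are
   not cycles in the graph-theoretic sense. *)
Definition combinatorial_tree : Prop :=
  [/\ symmetric adj, irreflexive adj, inhabited V,
      forall u v, exists p, path adj u p /\ last u p = v &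
      forall c, ucycle adj c -> (size c <= 2)%N].

(* Barycentric coordinates: the closed edge [u, v] if [adj u v], and the vertex
   [u] if [u = v]. *)
Definition cell (u v : V) : set (V -> R) :=
  [set p | [/\ forall w, 0 <= p w,
               forall w, ~ [set u; v] w -> p w = 0 &
               \sum_(w \in [set u; v]) p w = 1]].

Definition realization : set (V -> R) :=
  [set p | exists u v, (u = v \/ adj u v) /\ cell u v p].

(* [string p q r]: there is a chain of points from [p] to [q], consecutive points
   lying in a common closed edge, of total length [r], when each edge [u, v] is
   identified affinely with an interval of length [len u v]. *)
Inductive string : (V -> R) -> (V -> R) -> R -> Prop :=
| string_nil p : realization p -> string p p 0
| string_cons p p' q u v r :
    adj u v -> cell u v p -> cell u v p' -> string p' q r ->
    string p q (len u v * `|p u - p' u| + r).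

Definition realization_dist (p q : V -> R) : R := inf (string p q).

End Realization.

(* Edge lengths may vary, but are bounded away from 0, so that the vertices do
   not accumulate. *)
Definition is_simplicial_tree (X : metricType R) : Prop :=
  exists (V : choiceType) (adj : rel V) (len : V -> V -> R),
    [/\ combinatorial_tree adj,
        forall u v, len u v = len v u,
        exists2 e : R, 0 < e & forall u v, adj u v -> e <= len u v &
        exists f : (V -> R) -> X,
          set_bij (realization adj) setT f /\
          forall p q, realization adj p -> realization adj q ->
            mdist (f p) (f q) = realization_dist adj len p q].

End SimplicialTrees.

(* Main.v *)
(* Let g and h be hyperbolic with disjoint axes and let p be the end on the axis
   of g of the bridge between the axes. The elements g, g^-1 and h move p by
   integral distances in three different directions, and their inverses also move
   p in three different directions. Hence for every k that moves p one can choose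
   u and v among g, g^-1, h so that
     t(ukv) = d(p, up) + d(p, kp) + d(p, vp),
   and all distances d(p, kp) are integers. The union of the segments [p, kp] is
   an invariant subtree, so by minimality it is everything. The Gromov products of
   points of the orbit of p are half-integral, hence branching only occurs at
   half-integral distance from p; the points at such distances are the vertices. *)

Require Import Defs.
From mathcomp Require Import all_boot all_order all_algebra.
From mathcomp Require Import all_classical all_reals all_analysis.
From mathcomp Require Import lra.

Set Implicit Arguments.
Unset Strict Implicit.
Unset Printing Implicit Defensive.

Import Order.TTheory GRing.Theory Num.Theory.
Import numFieldTopology.Exports.

Local Open Scope classical_set_scope.
Local Open Scope ring_scope.

(** * Geometry of four-point metric spaces *)

Section FourPoint.
Variables (R : realType) (X : metricType R).
Implicit Types (x y z w p : X) (f : X -> X).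

Definition between x y z : Prop := mdist x y + mdist y z = mdist x z.

Definition geodesic : Prop :=
  forall x y t, 0 <= t <= mdist x y -> exists2 z, between x z y & mdist x z = t.

(** Gromov's 0-hyperbolicity: none of the three sums of opposite distances strictly exceeds both
    others. The maximum is split into a disjunction so that linear arithmetic applies in each
    case. *)
Definition four_point : Prop := forall x y z w,
  mdist x z + mdist y w <= mdist x y + mdist z w \/
  mdist x z + mdist y w <= mdist x w + mdist y z.

(* Twice the usual Gromov product. *)
Definition gprod p x y : R := mdist p x + mdist p y - mdist x y.

Definition isometric f : Prop := forall x y, mdist (f x) (f y) = mdist x y.

Lemma between_sym x y z : between x y z -> between z y x.
Proof.
rewrite /between (metric_sym z y) (metric_sym y x) (metric_sym z x); lra.
Qed.

Lemma between_trans x y z w : between x z w -> between x y z -> between x y w.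
Proof.
rewrite /between => xzw xyz.
have := metric_triangle x y w; have := metric_triangle y z w; lra.
Qed.

Lemma between_transr x y z w : between x z w -> between x y z -> between y z w.
Proof.
rewrite /between => xzw xyz.
have := metric_triangle x y w; have := metric_triangle y z w; lra.
Qed.

Lemma betweenl x y : between x x y.
Proof. by rewrite /between mdistxx add0r. Qed.

Lemma between_isometry f x y z :
  isometric f -> between x y z -> between (f x) (f y) (f z).
Proof. by rewrite /between => isof; rewrite !isof. Qed.

Lemma gprodC p x y : gprod p x y = gprod p y x.
Proof. by rewrite /gprod (metric_sym x y); lra. Qed.

Lemma gprod_ge0 p x y : 0 <= gprod p x y.
Proof.
by rewrite /gprod; have := metric_triangle x p y; rewrite (metric_sym x p); lra.
Qed.

Lemma gprod_le p x y : gprod p x y <= 2 * mdist p x.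
Proof. by rewrite /gprod; have := metric_triangle p x y; lra. Qed.

Lemma gprod_between p x y : between x p y <-> gprod p x y = 0.
Proof. by rewrite /between /gprod (metric_sym x p); split; lra. Qed.

Lemma between_gprod p x y : between p x y <-> gprod p x y = 2 * mdist p x.
Proof. by rewrite /between /gprod; split; lra. Qed.

Lemma translation_length_le f x : translation_length f <= mdist x (f x).
Proof.
apply: ge_inf; last by exists x.
by exists 0 => _ [y _ <-]; exact: mdist_ge0.
Qed.

Lemma axis_between f x z :
  isometric f -> axis f x -> between x z (f x) -> axis f z.
Proof.
rewrite /axis /between /= => isof xf xzf.
have := translation_length_le f z; have := isof x z.
have := metric_triangle z (f x) (f z); lra.
Qed.

Section Tree.
Hypotheses (geodX : geodesic) (fourX : four_point).

(** The four-point inequality seen from the base point [p]: segments from [p] that both follow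
    [p, y] for some length follow each other at least for the shorter of the two lengths. *)
Lemma gprod_ultrametric p x y z :
  gprod p x y <= gprod p x z \/ gprod p y z <= gprod p x z.
Proof.
rewrite /gprod; have [] := fourX p x y z; rewrite ?(metric_sym z); lra.
Qed.

Lemma between_dist x y y' z : between x y z -> between x y' z ->
  mdist x y <= mdist x y' -> mdist y y' = mdist x y' - mdist x y.
Proof.
rewrite /between => xyz xy'z.
have := metric_triangle x y y'.
by have [] := fourX x y z y'; rewrite ?(metric_sym z y'); lra.
Qed.

Lemma between_unique x y y' z : between x y z -> between x y' z ->
  mdist x y = mdist x y' -> y = y'.
Proof.
move=> xyz xy'z e; apply: mdist_positivity.
by rewrite (between_dist xyz xy'z) ?e ?subrr.
Qed.

(** [y] separates [x] from [z], so [w] cannot be on the side of both. This gives convexity of unions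
    of segments. *)
Lemma between_split x y z w : between x y z -> between x y w \/ between w y z.
Proof.
rewrite /between => xyz; have [] := fourX x y z w.
- have := metric_triangle w y z.
  by rewrite (metric_sym z w) (metric_sym w y); lra.
- by have := metric_triangle x y w; lra.
Qed.

(** In a tree local geodesics are geodesic; the overlap [y, z] must have positive length to forbid
    backtracking. *)
Lemma between_concat x y z w : between x y z -> between y z w -> y <> z ->
  mdist x w = mdist x y + mdist y z + mdist z w.
Proof.
rewrite /between => xyz yzw /eqP; rewrite -mdist_gt0 => yz0.
have := metric_triangle x y w; have := metric_triangle y z w.
by have [] := fourX x y z w; lra.
Qed.

(** * Translation lengths, axes and the bridge between two axes *)

Lemma iter_displacement f x n : isometric f -> between x (f x) (f (f x)) ->
  x <> f x -> mdist x (iter n f x) = n%:R * mdist x (f x).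
Proof.
move=> isof bx xfx; elim/ltn_ind: n => -[_|[_|n IH]].
- by rewrite /= mdistxx mul0r.
- by rewrite mul1r.
have e : mdist x (iter n.+1 f x) = n.+1%:R * mdist x (f x) by exact: IH.
have e' : mdist x (iter n f x) = n%:R * mdist x (f x) by exact: IH.
rewrite !iterS (@between_concat x (f x) (f (f x))) //.
- by rewrite !isof e' -[n.+2]addn2 natrD; lra.
- apply: between_isometry => //.
  by rewrite /between -iterS e iterS isof e' -[n.+1]addn1 natrD; lra.
- by move=> e2; move: xfx => /eqP; rewrite -mdist_gt0 -isof -e2 mdistxx ltxx.
Qed.

(** The orbit of [x] is geodesic, so [x] moves linearly under iteration. A point [y] with smaller
    displacement would have iterates staying within [mdist x y] of those of [x], which fails for
    large powers. *)
Lemma translation_length_between f x : isometric f ->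
  between x (f x) (f (f x)) -> x <> f x -> translation_length f = mdist x (f x).
Proof.
move=> isof bx xfx; apply/eqP; rewrite eq_le translation_length_le /=.
apply: lb_le_inf; first by exists (mdist x (f x)), x.
move=> _ [y _ <-]; rewrite leNgt; apply/negP => lt_yx.
have le_n n : n%:R * mdist x (f x) <= 2 * mdist x y + n%:R * mdist y (f y).
  rewrite -(iter_displacement n isof bx xfx).
  have : mdist y (iter n f y) <= n%:R * mdist y (f y).
    elim: n => [|n IH]; first by rewrite /= mdistxx mul0r.
    have := metric_triangle y (f y) (iter n.+1 f y).
    by rewrite [mdist (f y) _]isof -[n.+1]addn1 natrD; lra.
  have isoi : mdist (iter n f y) (iter n f x) = mdist x y.
    by rewrite metric_sym; elim: n => //= n; rewrite isof.
  have := metric_triangle x y (iter n f x).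
  by have := metric_triangle y (iter n f y) (iter n f x); rewrite isoi; lra.
have gap : 0 < mdist x (f x) - mdist y (f y) by rewrite subr_gt0.
have [n] : exists n, 2 * mdist x y / (mdist x (f x) - mdist y (f y)) < n%:R.
  exists (Num.bound (2 * mdist x y / (mdist x (f x) - mdist y (f y)))).
  by apply: archi_boundP; rewrite divr_ge0 ?mulr_ge0 ?mdist_ge0 ?(ltW gap).
by rewrite ltr_pdivrMr // => lt_n; have := le_n n; lra.
Qed.

(** If the segments [x, f x] and [f x, f (f x)] overlapped near [f x], the midpoint of the first
    would be displaced by less than the translation length. *)
Lemma axis_displacement f x : isometric f -> 0 < translation_length f ->
  axis f x -> between x (f x) (f (f x)).
Proof.
rewrite /axis /= => isof t_gt0 xf.
have [m xmf xm] : exists2 m, between x m (f x) & mdist x m = mdist x (f x) / 2.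
  by apply: geodX; rewrite xf; lra.
have fxm := between_isometry isof xmf.
apply/gprod_between/eqP; rewrite eq_le gprod_ge0 andbT leNgt.
apply/negP; have := translation_length_le f m; have := isof x m.
have := isof x (f x); move: xmf fxm; rewrite /between /gprod.
have [] := gprod_ultrametric (f x) m x (f (f x));
  have [] := gprod_ultrametric (f x) m (f (f x)) (f m);
  rewrite /gprod ?(metric_sym (f x) x)
    ?(metric_sym (f x) m) ?(metric_sym m x) ?(metric_sym (f (f x)) (f m)); lra.
Qed.

(** [p] is the last point of [a, b] on the axis; the supremum is attained since displacement is
    continuous. *)
Lemma axis_exit f a b : isometric f -> axis f a ->
  exists p, [/\ axis f p, between a p b &
    forall z, between p z b -> axis f z -> z = p].
Proof.
move=> isof af.
pose S := [set s | exists z, [/\ between a z b, mdist a z = s & axis f z]].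
have S0 : S 0 by exists a; rewrite mdistxx; split=> //; exact: betweenl.
have supS : has_sup S.
  split; first by exists 0.
  exists (mdist a b) => _ [z [azb <- _]].
  by move: azb; rewrite /between; have := mdist_ge0 z b; lra.
have leS s : S s -> s <= sup S by exact: (ub_le_sup supS.2).
have sup_ge0 : 0 <= sup S by exact: leS.
have sup_le : sup S <= mdist a b.
  apply: ge_sup; first by exists 0.
  move=> _ [z [azb <- _]].
  by move: azb; rewrite /between; have := mdist_ge0 z b; lra.
have [p apb ap] := geodX (introT andP (conj sup_ge0 sup_le)).
have pf : axis f p.
  apply/eqP; rewrite eq_le translation_length_le andbT leNgt.
  apply/negP => lt_p.
  (* Displacement changes at most twice as fast as the point, so a point of the axis within [e / 2]
     of [p] contradicts the excess [e] at [p]. *)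
  pose e := mdist p (f p) - translation_length f.
  have e_gt0 : 0 < e / 2 by rewrite /e; lra.
  have [_ [z [azb <- zf]] lt_z] := sup_adherent e_gt0 supS.
  have le_z : mdist a z <= mdist a p.
    by rewrite ap; apply: leS; exists z.
  have := between_dist azb apb le_z; have := isof z p.
  move: zf; rewrite /axis /=.
  have := metric_triangle p z (f p); have := metric_triangle z (f z) (f p).
  by rewrite (metric_sym p z) ap; move: lt_z lt_p; rewrite /e; lra.
exists p; split=> // z pzb zf; apply: esym; apply: mdist_positivity.
have azb : between a z b.
  exact/between_sym/(between_trans (between_sym apb))/between_sym.
have : mdist a z <= sup S by apply: leS; exists z.
have : between a p z.
  exact/between_sym/(between_transr (between_sym apb))/between_sym.
by rewrite /between ap; have := mdist_ge0 p z; lra.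
Qed.

Lemma axis_bridge f h : isometric f -> isometric h ->
  axis f !=set0 -> axis h !=set0 -> axis f `&` axis h = set0 ->
  exists p q, [/\ axis f p, axis h q, p <> q,
    forall z, between p z q -> axis f z -> z = p &
    forall z, between p z q -> axis h z -> z = q].
Proof.
move=> isof isoh [a af] [b bh] disj.
have [p [pf apb pP]] := axis_exit b isof af.
have [q [qh bqp qP]] := axis_exit p isoh bh.
exists p, q; split=> //.
- by move=> pq; rewrite -[False]/(set0 p) -disj; split=> //; rewrite pq.
- by move=> z pzq; apply: pP; apply: between_trans pzq; exact: between_sym.
- by move=> z pzq; apply: qP; exact: between_sym.
Qed.

(** The median of [x], [y] and [e] lies in [C], being on [x, e], and also on [x, y]; hence it is
    [x]. *)
Lemma between_meet (C : set X) e x y : (forall z, between x z e -> C z) ->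
  (forall z, between x z y -> C z -> z = x) -> between e x y.
Proof.
move=> xe xP.
have le1 := gprod_le x y e; have le2 := gprod_le x e y; rewrite gprodC in le2.
have [m xmy xm] : exists2 m, between x m y & mdist x m = gprod x y e / 2.
  by apply: geodX; have := gprod_ge0 x y e; lra.
have [n xne xn] : exists2 n, between x n e & mdist x n = gprod x y e / 2.
  by apply: geodX; have := gprod_ge0 x y e; lra.
have mn : m = n.
  apply: mdist_positivity; have := mdist_ge0 m n; move: xm xn xmy xne.
  rewrite /between; have [] := gprod_ultrametric x m y e;
    have [] := gprod_ultrametric x m e n;
    rewrite /gprod ?(metric_sym e n); lra.
have mx : m = x by apply: xP => //; apply: xe; rewrite mn.
by rewrite mx mdistxx in xm; apply/gprod_between; rewrite gprodC; lra.
Qed.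

End Tree.
End FourPoint.

(** * A base point with integral displacements *)

(** The pairwise disjunctions say that [P] and [Q] each fail for at most one of the three
    candidates, which leaves one for both. *)
Lemma pick_of_three (T : Type) (a b c : T) (P Q : T -> Prop) :
  P a \/ P b -> P a \/ P c -> P b \/ P c ->
  Q a \/ Q b -> Q a \/ Q c -> Q b \/ Q c ->
  exists x, [/\ [\/ x = a, x = b | x = c], P x & Q x].
Proof.
move=> Pab Pac Pbc Qab Qac Qbc.
have : P a /\ Q a \/ P b /\ Q b \/ P c /\ Q c by tauto.
by case=> [[Px Qx]|[[Px Qx]|[Px Qx]]]; [exists a | exists b | exists c];
  split=> //; [exact: Or31 | exact: Or32 | exact: Or33].
Qed.

Section IntegralOrbit.
Variables (R : realType) (X : metricType R) (G : groupType).
Variable act : G -> X -> X.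
Hypotheses (geodX : geodesic X) (fourX : four_point X).
Hypothesis isoG : isometric_action act.

Lemma act_isometry g : isometric (act g).
Proof. by case: isoG => _ _ iso x y; exact: iso. Qed.

Lemma actM g h x : act (g * h)%g x = act g (act h x).
Proof. by case: isoG => _ mul _; exact: mul. Qed.

Lemma actVK g x : act g^-1%g (act g x) = x.
Proof. by case: isoG => act1 _ _; rewrite -actM mulVg. Qed.

Lemma actKV g x : act g (act g^-1%g x) = x.
Proof. by case: isoG => act1 _ _; rewrite -actM mulgV. Qed.

Lemma act_between g x y z :
  between x y z <-> between (act g x) (act g y) (act g z).
Proof. by rewrite /between !act_isometry. Qed.

Lemma mdist_actV g x : mdist x (act g^-1%g x) = mdist x (act g x).
Proof. by rewrite -(act_isometry g) actKV metric_sym. Qed.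

Section PingPong.
Variables (p : X) (a b c : G).

(** The segments from [p] to its two images leave [p] in different directions. *)
Definition separated (x y : G) : Prop :=
  gprod p (act x p) (act y p) = 0.

Definition integral (k : G) : Prop := mdist p (act k p) \is a Num.int.

Lemma separated_sym x y : separated x y -> separated y x.
Proof. by rewrite /separated gprodC. Qed.

Lemma separated_or x y z : separated x y -> separated x z \/ separated y z.
Proof.
rewrite /separated => xy0.
have := gprod_ge0 p (act x p) (act z p).
have := gprod_ge0 p (act y p) (act z p).
have [] := gprod_ultrametric fourX p (act x p) (act z p) (act y p);
  rewrite xy0 ?(gprodC p (act z p)) => ? ? ?; [left | right]; lra.
Qed.

Hypotheses (intG : forall g, translation_length (act g) \is a Num.int).
Hypotheses (a_p : act a p <> p) (b_p : act b p <> p) (c_p : act c p <> p).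
Hypotheses (inta : integral a) (intb : integral b) (intc : integral c).
Hypotheses (ab : separated a b) (ac : separated a c) (bc : separated b c).
Hypotheses (abV : separated a^-1%g b^-1%g) (acV : separated a^-1%g c^-1%g)
  (bcV : separated b^-1%g c^-1%g).

(* The hypotheses say that the segments [p, up], [up, ukp], [ukp, ukvp] form a
   geodesic, and that together with its translate by ukv it still is one, so that
   [p] is on the axis of ukv. *)
Lemma translation_length_sandwich u k v :
  act u p <> p -> act v p <> p -> act k p <> p ->
  separated u^-1%g k -> separated k^-1%g v -> separated v^-1%g u ->
  translation_length (act (u * k * v)%g) =
    mdist p (act u p) + mdist p (act k p) + mdist p (act v p).
Proof.
move=> up vp kp uk kv vu; set w := (u * k * v)%g.
have b1 : between p (act u p) (act u (act k p)).
  by rewrite (act_between u^-1%g) !actVK; apply/gprod_between.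
have b2 : between p (act k p) (act k (act v p)).
  by rewrite (act_between k^-1%g) !actVK; apply/gprod_between.
have ukp : act u p <> act u (act k p).
  by move=> /(congr1 (act u^-1%g)); rewrite !actVK => /esym.
have wE : act w p = act u (act k (act v p)) by rewrite /w !actM.
have b2u := b2; rewrite (act_between u) in b2u.
have pw : mdist p (act w p) =
    mdist p (act u p) + mdist p (act k p) + mdist p (act v p).
  by rewrite wE (between_concat fourX b1 b2u ukp) !act_isometry.
have dist_gt0 g : act g p <> p -> 0 < mdist p (act g p).
  by move=> gp; rewrite mdist_gt0; apply/eqP => /esym.
have up0 := dist_gt0 _ up; have vp0 := dist_gt0 _ vp; have kp0 := dist_gt0 _ kp.
rewrite -pw; apply: translation_length_between => //.
- exact: act_isometry.
(* After pulling back by [w], the segments from [p] to its images under [w^-1] and [w] must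
   separate. By [e2] and [e1] they begin with the segments to the images under [v^-1] and [u], which
   separate by [vu]. *)
- rewrite (act_between w^-1%g) !actVK; apply/gprod_between.
  have pwV := mdist_actV w p.
  have e1 : mdist (act w p) (act u p) = mdist p (act k p) + mdist p (act v p).
    by rewrite metric_sym wE act_isometry -b2 act_isometry.
  have e2 : mdist (act w^-1%g p) (act v^-1%g p) =
      mdist p (act u p) + mdist p (act k p).
    rewrite -(act_isometry w) actKV /w !actM actKV -b1 act_isometry.
    by rewrite metric_sym metric_sym.
  have := gprod_ge0 p (act w^-1%g p) (act w p).
  have vV := mdist_actV v p; move: vu.
  have [] := gprod_ultrametric fourX p (act v^-1%g p) (act w^-1%g p) (act u p);
    have [] := gprod_ultrametric fourX p (act w^-1%g p) (act w p) (act u p);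
    rewrite /separated /gprod ?(metric_sym (act v^-1%g p) (act w^-1%g p))
      ?e1 ?e2 ?vV ?pwV ?pw; lra.
- move=> wp; have : mdist p (act w p) = 0 by rewrite -wp mdistxx.
  by rewrite pw; lra.
Qed.

(* Each direction at [p] is excluded by at most one of [a], [b], [c], hence some
   [u] and [v] among them sandwich [k]. *)
Lemma integral_orbit k : integral k.
Proof.
have [kp|kp] := pselect (act k p = p); first by rewrite /integral kp mdistxx.
have pair x y z : separated x y -> separated z x \/ separated z y.
  by case/(@separated_or x y z) => /separated_sym; [left | right].
(* Only the direction of [k^-1] restricts [v], so the second predicate is trivial; [u], chosen next,
   must avoid the directions of both [k] and [v^-1]. *)
have [v [v_abc kv _]] := pick_of_three (P := separated k^-1%g) (Q := fun=> True)
  (pair _ _ _ ab) (pair _ _ _ ac) (pair _ _ _ bc)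
  (or_introl I) (or_introl I) (or_introl I).
have [u [u_abc uk vu]] := pick_of_three
  (P := fun u => separated u^-1%g k) (Q := separated v^-1%g)
  (separated_or _ abV) (separated_or _ acV) (separated_or _ bcV)
  (pair _ _ _ ab) (pair _ _ _ ac) (pair _ _ _ bc).
have prop_abc g : [\/ g = a, g = b | g = c] -> act g p <> p /\ integral g.
  by case=> ->.
have [vp intv] := prop_abc _ v_abc; have [up intu] := prop_abc _ u_abc.
have := translation_length_sandwich up vp kp uk kv vu.
rewrite /integral; set t := translation_length _ => tE.
have -> : mdist p (act k p) = t - mdist p (act u p) - mdist p (act v p).
  by rewrite tE; lra.
by rewrite !rpredB // intG.
Qed.

End PingPong.

Lemma integral_orbit_exists :
  irreducible_action act ->
  (forall g, translation_length (act g) \is a Num.int) ->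
  exists p, forall k, mdist p (act k p) \is a Num.int.
Proof.
move=> [g [h [[tg [fg [_ axg]]] [th [fh [_ axh]]] disj]]] intG.
have [isog isoh] := (act_isometry g, act_isometry h).
have [||p [q [pg qh pq pP qP]]] := axis_bridge geodX fourX isog isoh _ _ disj.
- by exists (fg 0); rewrite -axg; exists 0.
- by exists (fh 0); rewrite -axh; exists 0.
have bg := axis_displacement geodX fourX isog tg pg.
have bh := axis_displacement geodX fourX isoh th qh.
have axisV k x : axis (act k) x -> axis (act k) (act k^-1%g x).
  by rewrite /axis /= => xk; rewrite actKV -(act_isometry k) actKV.
(* Both neighbours of [x] in its [k]-orbit lie along the axis, whereas [x, y] leaves the axis at
   once. *)
have tree_meet2 k x y : axis (act k) x ->
    (forall z, between x z y -> axis (act k) z -> z = x) ->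
    between (act k x) x y /\ between (act k^-1%g x) x y.
  move=> xk xP; split;
    apply: (between_meet geodX fourX (C := axis (act k))) => // z xz.
  - exact: (axis_between (act_isometry k) xk xz).
  - apply: (axis_between (act_isometry k) (axisV _ _ xk)).
    by rewrite actKV; exact: between_sym.
have [gpq gVpq] := tree_meet2 _ _ _ pg pP.
have [hqp hVqp] : between (act h q) q p /\ between (act h^-1%g q) q p.
  by apply: tree_meet2 => // z /between_sym; exact: qP.
have qhq : q <> act h q.
  move=> e; move: th qh; rewrite /axis /= -e mdistxx => /[swap] <-.
  by rewrite ltxx.
have pgp : p <> act g p.
  move=> e; move: tg pg; rewrite /axis /= -e mdistxx => /[swap] <-.
  by rewrite ltxx.
(* The bridge [p, q], the step [q, hq] and the translated bridge [hq, hp] concatenate, so [h] and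
   likewise [h^-1] move [p] in the direction of the bridge. *)
have pqh : between p q (act h p).
  have b := hVqp; rewrite (act_between h) actKV in b.
  rewrite /between (between_concat fourX (between_sym hqp) b qhq).
  by rewrite -addrA b.
have pqhV : between p q (act h^-1%g p).
  have b := hqp; rewrite (act_between h^-1%g) actVK in b.
  have qhVq : q <> act h^-1%g q.
    by move=> /(congr1 (act h)); rewrite actKV => /esym.
  rewrite /between (between_concat fourX (between_sym hVqp) b qhVq).
  by rewrite -addrA b.
have sep x y : between (act x p) p q -> between p q (act y p) ->
    separated p x y.
  move=> xq qy; apply/gprod_between.
  by rewrite /between (between_concat fourX xq qy pq) -qy addrA.
have sggV : separated p g g^-1%g.
  apply/gprod_between/between_sym; rewrite (act_between g) actKV; exact: bg.
have sgh := sep _ _ gpq pqh; have sgVh := sep _ _ gVpq pqh.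
have sghV := sep _ _ gpq pqhV; have sgVhV := sep _ _ gVpq pqhV.
have gp : act g p <> p by move=> /esym.
have gVp : act g^-1%g p <> p.
  by move=> /(congr1 (act g)); rewrite actKV => /esym.
have hp : act h p <> p.
  move=> e; rewrite e /between mdistxx in pqh.
  by move: pq => /eqP; rewrite -mdist_gt0; have := mdist_ge0 q p; lra.
have intg : integral p g by rewrite /integral (pg : mdist _ _ = _).
exists p; apply: (@integral_orbit p g g^-1%g h) => //.
- by rewrite /integral mdist_actV.
(* [p] is not on the axis of [h], but the sandwich with [u = k = g] and [v = h] gives t(ggh) = 2
   d(p, gp) + d(p, hp), where d(p, gp) = t(g). *)
- have := translation_length_sandwich gp hp gp (separated_sym sggV) sgVh
    (separated_sym sghV).
  set t := translation_length _ => tE; rewrite /integral.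
  have -> : mdist p (act h p) = t - mdist p (act g p) - mdist p (act g p).
    by rewrite tE; lra.
  by rewrite !rpredB // intG.
- by rewrite invgK; exact: separated_sym.
- by rewrite invgK.
Qed.

End IntegralOrbit.

(** * R-trees as geodesic four-point spaces *)

Section RtreeGeometry.
Variables (R : realType) (X : metricType R).
Implicit Types (x y z : X) (c : R -> X).

Lemma lipschitz_within_continuous (a b : R) c :
  (forall s t, a <= s <= b -> a <= t <= b -> mdist (c s) (c t) <= `|s - t|) ->
  {within `[a, b], continuous c}.
Proof.
move=> lip; apply/subspace_continuousP => s; rewrite /= in_itv /= => sab.
apply/metricType_numDomainType.cvgrPdist_lt => e e_gt0.
rewrite near_withinE; near=> t; rewrite /= in_itv /= => tab.
by apply: le_lt_trans (lip _ _ sab tab) _; near: t; apply/nbhs_ballP; exists e.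
Unshelve. all: by end_near. Qed.

Definition unit_speed (L : R) c : Prop := forall s t,
  0 <= s <= L -> 0 <= t <= L -> mdist (c s) (c t) = `|s - t|.

Lemma unit_speed_arc (Y : set X) (L : R) c : 0 <= L -> unit_speed L c ->
  c @` `[0, L] `<=` Y -> is_arc Y (c 0) (c L) (c @` `[0, L]).
Proof.
move=> L_ge0 cL cY; exists 0, L, c; split=> //.
- by split=> //; apply: lipschitz_within_continuous => s t sL tL; rewrite cL.
- move=> s t; rewrite !inE /= !in_itv /= => sL tL st.
  have := cL _ _ sL tL; rewrite st mdistxx => /esym/eqP.
  by rewrite normr_eq0 subr_eq0 => /eqP.
Qed.

Lemma unit_speed_between (L : R) c s : unit_speed L c -> 0 <= s <= L ->
  between (c 0) (c s) (c L).
Proof.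
move=> cL sL; have L_ge0 : 0 <= L by lra.
have [L0 LL] : 0 <= (0 : R) <= L /\ 0 <= L <= L by rewrite !lexx L_ge0.
by rewrite /between !cL // !ler0_norm; lra.
Qed.

Section Tree.
Hypothesis treeX : is_Rtree [set: X].

Lemma arc_unique x y (A B : set X) :
  is_arc [set: X] x y A -> is_arc [set: X] x y B -> A = B.
Proof.
move=> arcA arcB; have [[C [_ uC]] _] := treeX.2 x y I I.
by rewrite -(uC A arcA) (uC B arcB).
Qed.

Lemma unit_speed_exists x y :
  exists c, [/\ unit_speed (mdist x y) c, c 0 = x & c (mdist x y) = y].
Proof.
have [[A [arcA _]] /(_ A arcA) [i [f [isof fA]]]] := treeX.2 x y I I.
have [a [b [c [[ab _ _ ca cb] _ AE]]]] := arcA.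
have [s si fs] : (f @` [set` i]) x.
  by rewrite fA AE -ca; exists a => //=; rewrite in_itv /= lexx ab.
have [t ti ft] : (f @` [set` i]) y.
  by rewrite fA AE -cb; exists b => //=; rewrite in_itv /= lexx ab.
have itv_i u v r : [set` i] u -> [set` i] v -> u <= r <= v -> [set` i] r.
  by move=> ui vi; exact: (interval_is_interval ui vi).
have xy : mdist x y = `|s - t| by rewrite -fs -ft isof.
(* The isometric parametrization of the arc may run from [x] to [y] or backwards. *)
case: (leP s t) => st.
- have {}xy : mdist x y = t - s by rewrite xy ler0_norm; lra.
  exists (fun u => f (s + u)).
  rewrite xy addr0 fs [s + (t - s)]addrC subrK ft; split=> //.
  move=> u v uL vL; rewrite isof.
  + by congr `|_|; lra.
  + by apply: (itv_i s t) => //; lra.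
  + by apply: (itv_i s t) => //; lra.
- have {}xy : mdist x y = s - t by rewrite xy ger0_norm; lra.
  exists (fun u => f (s - u)); rewrite xy subr0 fs subKr ft; split=> //.
  move=> u v uL vL; rewrite isof.
  + by rewrite -normrN; congr `|_|; lra.
  + by apply: (itv_i t s) => //; lra.
  + by apply: (itv_i t s) => //; lra.
Qed.

(* Two geodesics which only meet at a common end form an arc, and the unique arc
   between its ends is the geodesic. *)
Lemma joint_on_geodesic (L1 L2 L : R) (c1 c2 c : R -> X) :
  0 <= L1 -> 0 <= L2 -> 0 <= L ->
  unit_speed L1 c1 -> unit_speed L2 c2 -> unit_speed L c ->
  c1 L1 = c2 0 -> c 0 = c1 0 -> c L = c2 L2 ->
  (forall s t, 0 <= s <= L1 -> 0 <= t <= L2 -> c1 s = c2 t ->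
     s = L1 /\ t = 0) ->
  exists2 s, 0 <= s <= L & c s = c1 L1.
Proof.
move=> L1_ge0 L2_ge0 L_ge0 c1L c2L cL c12 c0 cLE meet.
pose k u := if u <= L1 then c1 u else c2 (u - L1).
have kl u : u <= L1 -> k u = c1 u by rewrite /k => ->.
have kr u : L1 <= u -> k u = c2 (u - L1).
  by rewrite /k le_eqVlt => /predU1P[<-|/lt_geF ->//]; rewrite lexx subrr.
have k_lip s t : s <= t -> 0 <= s <= L1 + L2 -> 0 <= t <= L1 + L2 ->
    mdist (k s) (k t) <= `|s - t|.
  move=> st sL tL; rewrite (ler0_norm (_ : s - t <= 0)); last by lra.
  have [tL1|L1t] := leP t L1.
    by rewrite !kl ?c1L ?ler0_norm; lra.
  have [L1s|sL1] := leP L1 s.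
    by rewrite !kr ?c2L ?ler0_norm; lra.
  rewrite kl ?kr; [|lra|lra].
  have := metric_triangle (c1 s) (c1 L1) (c2 (t - L1)).
  rewrite c1L; [|lra|lra]; rewrite c12 c2L; [|lra|lra].
  by rewrite !ler0_norm; lra.
have arck : is_arc [set: X] (c1 0) (c2 L2) (k @` `[0, L1 + L2]).
  exists 0, (L1 + L2), k; split=> //.
  - split=> //; first by lra.
    + apply: lipschitz_within_continuous => s t sL tL.
      have [st|ts] := leP s t; first exact: k_lip.
      by rewrite metric_sym distrC; apply: k_lip => //; exact: ltW.
    + by rewrite kl.
    + by rewrite kr; [congr c2; lra|lra].
  - have inj s t : s <= t -> 0 <= s <= L1 + L2 -> 0 <= t <= L1 + L2 ->
        k s = k t -> s = t.
      move=> st sL tL.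
      have [tL1|L1t] := leP t L1.
        rewrite !kl //; last by lra.
        move=> e; have := c1L s t; rewrite e mdistxx => h.
        by have := h ltac:(lra) ltac:(lra); rewrite ler0_norm; lra.
      have [L1s|sL1] := leP L1 s.
        rewrite !kr //; last by lra.
        move=> e; have := c2L (s - L1) (t - L1); rewrite e mdistxx => h.
        by have := h ltac:(lra) ltac:(lra); rewrite ler0_norm; lra.
      rewrite kl ?kr; [|lra|lra].
      by move=> /meet []; lra.
    move=> s t; rewrite !inE /= !in_itv /= => sL tL st.
    have [le_st|le_ts] := leP s t; first exact: inj.
    by apply: esym; apply: inj => //; exact: ltW.
have arcc := unit_speed_arc L_ge0 cL (@subsetT _ _).
rewrite c0 cLE in arcc.
have : (k @` `[0, L1 + L2]) (c1 L1).
  by exists L1; rewrite ?kl //= in_itv /=; lra.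
by rewrite (arc_unique arck arcc) => -[s]; rewrite /= in_itv /= => sL; exists s.
Qed.

(** The geodesics [x, m] and [m, y] meet only at [m] because [m] is between the ends, so the
    geodesic [c] passes through [m]. Uniqueness of arcs thus becomes uniqueness of intermediate
    points. *)
Lemma between_on_geodesic x y m c : unit_speed (mdist x y) c ->
  c 0 = x -> c (mdist x y) = y -> between x m y -> c (mdist x m) = m.
Proof.
move=> cL c0 cE xmy.
have [c1 [c1L c10 c1E]] := unit_speed_exists x m.
have [c2 [c2L c20 c2E]] := unit_speed_exists m y.
have dxm := mdist_ge0 x m; have dmy := mdist_ge0 m y.
have [||||s sL cs] := @joint_on_geodesic (mdist x m) (mdist m y) (mdist x y)
  c1 c2 c dxm dmy (mdist_ge0 x y) c1L c2L cL.
- by rewrite c1E c20.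
- by rewrite c0 c10.
- by rewrite cE c2E.
- move=> s t sL tL e.
  have := c1L 0 s; rewrite c10 sub0r normrN ger0_norm; last by lra.
  move=> h1; have {}h1 := h1 ltac:(lra) sL.
  have := c2L t (mdist m y); rewrite c2E -e ler0_norm; last by lra.
  move=> h2; have {}h2 := h2 tL ltac:(lra).
  by have := metric_triangle x (c1 s) y; move: xmy; rewrite /between; lra.
have := cL 0 s; rewrite c0 sub0r normrN ger0_norm; last by lra.
move=> h; have {}h := h ltac:(lra) sL.
rewrite cs c1E in h.
by rewrite h cs c1E.
Qed.

Lemma Rtree_between_unique x y m m' : between x m y -> between x m' y ->
  mdist x m = mdist x m' -> m = m'.
Proof.
move=> xmy xm'y e; have [c [cL c0 cE]] := unit_speed_exists x y.
by rewrite -(between_on_geodesic cL c0 cE xmy) e (between_on_geodesic cL c0 cE).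
Qed.

Lemma Rtree_geodesic : geodesic X.
Proof.
move=> x y t tL; have [c [cL c0 cE]] := unit_speed_exists x y.
exists (c t); first by have := unit_speed_between cL tL; rewrite c0 cE.
have := cL 0 t; rewrite c0 sub0r normrN ger0_norm; last by lra.
by apply => //; lra.
Qed.

(** [m] is the last common point of the geodesics from [x] to [y] and to [z]. Their remainders meet
    only there, so they join up to the geodesic from [y] to [z]. *)
Lemma Rtree_tripod x y z :
  exists m, [/\ between x m y, between x m z & between y m z].
Proof.
have [c [cL c0 cE]] := unit_speed_exists x y.
have [e [eL e0 eE]] := unit_speed_exists x z.
have dxy := mdist_ge0 x y; have dxz := mdist_ge0 x z.
pose S := [set s | [/\ 0 <= s <= mdist x y, 0 <= s <= mdist x z & c s = e s]].
have S0 : S 0 by split; [lra | lra | rewrite c0 e0].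
have supS : has_sup S.
  by split; [exists 0 | exists (mdist x y) => s [/andP[]]].
have leS s : S s -> s <= sup S by exact: (ub_le_sup supS.2).
pose r := sup S.
have r0 : 0 <= r by exact: leS.
have rxy : r <= mdist x y.
  by apply: ge_sup; [exists 0 | move=> s [/andP[]]].
have rxz : r <= mdist x z.
  by apply: ge_sup; [exists 0 | move=> s [_ /andP[]]].
have cr : c r = e r.
  apply: mdist_positivity; apply/eqP; rewrite eq_le mdist_ge0 andbT leNgt.
  apply/negP => lt0.
  (* Both geodesics have unit speed, so agreement at [s] bounds their distance at [r] by
     [2 * (r - s)]; half that distance is therefore the right tolerance. *)
  have [s Ss lt_s] := sup_adherent (divr_gt0 lt0 (ltr0n _ 2)) supS.
  have le_s := leS _ Ss; have [sxy sxz cs] := Ss.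
  have := metric_triangle (c r) (c s) (e r).
  rewrite [in X in _ <= _ + X]cs cL ?eL; [|lra..].
  rewrite -/r in lt_s le_s; rewrite ger0_norm; last by lra.
  by rewrite ler0_norm; lra.
have xcy := unit_speed_between cL (introT andP (conj r0 rxy)).
have xez := unit_speed_between eL (introT andP (conj r0 rxz)).
rewrite c0 cE in xcy; rewrite e0 eE -cr in xez.
exists (c r); split=> //.
have [k [kL k0 kE]] := unit_speed_exists y z.
have [||||||||||s sL ks] := @joint_on_geodesic (mdist x y - r) (mdist x z - r)
  (mdist y z) (fun u => c (mdist x y - u)) (fun u => e (r + u)) k.
- by lra.
- by lra.
- exact: mdist_ge0.
- by move=> u v uL vL; rewrite cL; [rewrite -normrN; congr `|_|; lra | lra..].
- by move=> u v uL vL; rewrite eL; [congr `|_|; lra | lra..].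
- by [].
- by rewrite subKr addr0.
- by rewrite k0 subr0.
- by rewrite kE addrC subrK.
- move=> u v uL vL ce.
  have h1 := cL 0 (mdist x y - u) ltac:(lra) ltac:(lra).
  have h2 := eL 0 (r + v) ltac:(lra) ltac:(lra).
  rewrite c0 sub0r normrN ger0_norm in h1; last by lra.
  rewrite e0 sub0r normrN ger0_norm in h2; last by lra.
  have uv : mdist x y - u = r + v by rewrite -h1 -h2 ce.
  have : S (r + v) by split; [lra | lra | rewrite -{1}uv].
  by move=> /leS; rewrite -/r; lra.
by rewrite subKr in ks; have := unit_speed_between kL sL; rewrite ks k0 kE.
Qed.

(** The medians [m] of x, y, z and [n] of x, z, w both lie on [x, z]. The one nearer to [x] lies on
    the segments from [x] to all three other points, and routing [mdist y w] through it gives the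
    inequality. *)
Lemma Rtree_four_point : four_point X.
Proof.
move=> x y z w.
have [m [xmy xmz ymz]] := Rtree_tripod x y z.
have [n [xnz xnw znw]] := Rtree_tripod x z w.
have shorter a b u : between x a z -> between x b z -> between x b u ->
    mdist x a <= mdist x b -> between x a u.
  move=> xaz xbz xbu ab.
  have [a' xa'b a'a] := Rtree_geodesic (introT andP (conj (mdist_ge0 x a) ab)).
  have <- : a' = a.
    by apply: (Rtree_between_unique _ xaz) => //; exact: between_trans xa'b.
  exact: between_trans xa'b.
have [mn|nm] := leP (mdist x m) (mdist x n).
- have xmw := shorter _ _ _ xmz xnz xnw mn; right.
  have := metric_triangle y m w; move: xmy xmz ymz xmw.
  by rewrite /between (metric_sym y m); lra.
- have xny := shorter _ _ _ xnz xmz xmy (ltW nm); left.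
  have := metric_triangle y n w; move: xny xnz xnw znw.
  by rewrite /between (metric_sym y n) (metric_sym z n); lra.
Qed.

Lemma path_length_ge (Y : set X) (a b : R) c x y : is_path Y a b c x y ->
  ((mdist x y)%:E <= path_length a b c)%E.
Proof.
case=> ab _ _ <- <-; have [<-|/eqP ab'] := pselect (a = b).
  rewrite mdistxx; apply: ereal_sup_ubound; exists [::] => //=.
  by rewrite /path_variation big_nil.
apply: ereal_sup_ubound; exists [:: b].
  by apply: itv_partition1; rewrite lt_neqAle ab'.
by rewrite /path_variation /= big_nat1 /= metric_sym.
Qed.

(** Each partition sum is that of the identity on [0, L], a monotone function of variation [L]. *)
Lemma path_length_unit_speed (L : R) c : unit_speed L c ->
  (path_length 0 L c <= L%:E)%E.
Proof.
move=> cL; apply: ge_ereal_sup => _ [s sL <-]; rewrite lee_fin.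
have vL : variation 0 L id s = L.
  by rewrite nondecreasing_variation //= subr0.
rewrite -[leRHS]vL /path_variation /variation /= big_nat [leRHS]big_nat.
apply: ler_sum => n /= ns.
have itv k : (k < (size s).+1)%N -> 0 <= nth L (0 :: s) k <= L.
  by move=> ks; rewrite itv_partition_nth_ge // itv_partition_nth_le.
by have /= -> := cL _ _ (itv n.+1 ns) (itv n (ltnW ns)).
Qed.

(** Geodesics between points of [Y] stay in [Y], and arcs in [Y] are arcs in [X], so existence,
    uniqueness and lengths are inherited. *)
Lemma convex_Rtree (Y : set X) :
  (forall x y z, Y x -> Y z -> between x y z -> Y y) -> is_Rtree Y.
Proof.
move=> convY.
have geoY x y : Y x -> Y y -> exists c, [/\ unit_speed (mdist x y) c, c 0 = x,
    c (mdist x y) = y & c @` `[0, mdist x y] `<=` Y].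
  move=> Yx Yy; have [c [cL c0 cE]] := unit_speed_exists x y.
  exists c; split=> // _ [s /= + <-]; rewrite in_itv /= => sL.
  apply: (convY x _ y) => //.
  by have := unit_speed_between cL sL; rewrite c0 cE.
have arcYT x y A : is_arc Y x y A -> is_arc [set: X] x y A.
  by move=> [a [b [c [[ab cc _ ca cb] inj AE]]]]; exists a, b, c.
split=> [x y Yx Yy|x y Yx Yy].
- have [c [cL c0 cE cY]] := geoY _ _ Yx Yy.
  apply/eqP; rewrite eq_le; apply/andP; split.
    apply: le_ereal_inf_tmp => _ [a [b [k [kxy ->]]]].
    exact: path_length_ge kxy.
  apply: le_trans (path_length_unit_speed cL).
  apply: ereal_inf_lbound; exists 0, (mdist x y), c; split=> //; split=> //.
  + exact: mdist_ge0.
  + by apply: lipschitz_within_continuous => s t sL tL; rewrite cL.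
- split; last by move=> A /arcYT; exact: (treeX.2 x y I I).2.
  have [c [cL c0 cE cY]] := geoY _ _ Yx Yy.
  have := unit_speed_arc (mdist_ge0 x y) cL cY; rewrite c0 cE => arcc.
  exists (c @` `[0, mdist x y]); split=> // B /arcYT.
  exact: (arc_unique (arcYT _ _ _ arcc)).
Qed.

End Tree.
End RtreeGeometry.

(** * The simplicial structure *)

Section Realization.
Variables (R : realType) (V : choiceType) (adj : rel V) (len : V -> V -> R).

Lemma string_cat q1 q2 q3 r s : string adj len q1 q2 r ->
  string adj len q2 q3 s -> string adj len q1 q3 (r + s).
Proof.
elim=> [q _|q q' q'' u v r' uv qc q'c _ IH] st; first by rewrite add0r.
by rewrite -addrA; apply: string_cons uv qc q'c _; exact: IH.
Qed.

Lemma string1 u v q q' : adj u v -> cell u v q -> cell u v q' ->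
  string adj len q q' (len u v * `|q u - q' u|).
Proof.
move=> uv qc q'c; rewrite -[X in string _ _ _ _ X]addr0.
apply: (string_cons uv qc q'c); apply: string_nil.
by exists u, v; split=> //; right.
Qed.

Lemma string_sym q q' r : string adj len q q' r -> string adj len q' q r.
Proof.
elim=> [q0 rq|q0 q1 q2 u v r' uv q0c q1c _ IH]; first exact: string_nil.
by rewrite addrC distrC; apply: string_cat IH _; exact: string1.
Qed.

Lemma sum_cell (u v : V) (q : V -> R) : u <> v ->
  \sum_(w \in [set u; v]) q w = q u + q v.
Proof.
move=> uv; rewrite fsbigU ?fsbig_set1 //; try exact: finite_set1.
by move=> w [/= -> /uv].
Qed.

End Realization.

Lemma seq_max (T : eqType) (R : realDomainType) (f : T -> R) (s : seq T) :
  s != [::] -> exists2 x, x \in s & forall y, y \in s -> f y <= f x.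
Proof.
elim: s => [//|a [|b s] IH] _.
  by exists a => [|y]; rewrite inE // => /eqP ->.
have [x xs xP] := IH isT.
have [ax|xa] := leP (f a) (f x).
- by exists x => [|y]; rewrite inE ?xs ?orbT // => /predU1P[->|/xP].
- exists a => [|y]; first by rewrite inE eqxx.
  by rewrite inE => /predU1P[->//|/xP yx]; exact: le_trans yx (ltW xa).
Qed.

Section HalfIntegralTree.
Variables (R : realType) (X : metricType R) (p : X) (E : set X).
Hypotheses (geodX : geodesic X) (fourX : four_point X).
Hypothesis coverE : forall x, exists2 e, E e & between p x e.
Hypothesis int_pE : forall e, E e -> mdist p e \is a Num.int.
Hypothesis int_EE : forall e e', E e -> E e' -> mdist e e' \is a Num.int.
Implicit Types x y z : X.

(* The vertices lie at half-integral distance from the root [p]; they include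
   all branch points, because the Gromov products of points of [E] are
   half-integral. All edges have length 1/2. *)
Definition vertex x : bool := 2 * mdist p x \is a Num.nat.

Local Notation V := {x : X | vertex x}.
Implicit Types u v w : V.

Definition parent (x y : X) : Prop := between p x y /\ mdist x y = 2^-1.

Definition edge u v : bool :=
  `[< parent (val u) (val v) \/ parent (val v) (val u) >].

(** Initial parts of [p, e] and [p, e'] diverge where these segments do, unless one of the parts
    ends before. *)
Lemma gprod_meet x y e e' : between p x e -> between p y e' ->
  [\/ gprod p x y = 2 * mdist p x, gprod p x y = 2 * mdist p y |
      gprod p x y = gprod p e e'].
Proof.
move=> /between_gprod xe /between_gprod ye'.
have lex := gprod_le p x y; have ley := gprod_le p y x; rewrite gprodC in ley.
have [eqx|/eqP nex] := pselect (gprod p x y = 2 * mdist p x); first exact: Or31.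
have [eqy|/eqP ney] := pselect (gprod p x y = 2 * mdist p y); first exact: Or32.
have {lex nex} ltx : gprod p x y < 2 * mdist p x by rewrite lt_neqAle nex.
have {ley ney} lty : gprod p x y < 2 * mdist p y by rewrite lt_neqAle ney.
apply: Or33; apply/eqP; rewrite eq_le; apply/andP; split.
- have [] := gprod_ultrametric fourX p e x y;
    have [] := gprod_ultrametric fourX p e y e';
    rewrite ?(gprodC p e x); lra.
- have [] := gprod_ultrametric fourX p x e e';
    have [] := gprod_ultrametric fourX p x e' y;
    rewrite ?(gprodC p e' y); lra.
Qed.

Lemma gprod_vertex u v : gprod p (val u) (val v) \is a Num.nat.
Proof.
have [e Ee ue] := coverE (val u); have [e' Ee' ve'] := coverE (val v).
have [-> | -> | ->] := gprod_meet ue ve'; [exact: (valP u) | exact: (valP v) |].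
rewrite natrEint gprod_ge0 andbT.
by apply: rpredB; [apply: rpredD; exact: int_pE | exact: int_EE].
Qed.

(** Distances between vertices are half-integral, since distances to the root and Gromov products
    are. *)
Lemma vertex_dist u v : u <> v -> 2^-1 <= mdist (val u) (val v).
Proof.
move=> uv; have : 2 * mdist (val u) (val v) \is a Num.nat.
  have -> : 2 * mdist (val u) (val v) =
      2 * mdist p (val u) + 2 * mdist p (val v) -
      2 * gprod p (val u) (val v) by rewrite /gprod; lra.
  rewrite natrEint; apply/andP; split; last first.
    by have := mdist_ge0 (val u) (val v); rewrite /gprod; lra.
  apply: rpredB.
    by apply: rpredD; apply: intr_nat; [exact: (valP u) | exact: (valP v)].
  by apply: rpredM; [exact: rpred_nat | apply: intr_nat; exact: gprod_vertex].
case/natrP => n dn; have : 0 < n%:R :> R.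
  by rewrite -dn mulr_gt0 // mdist_gt0; apply/eqP => /val_inj.
rewrite ltr0n -(ler1n R); move: dn => <- {uv}; lra.
Qed.

Lemma parent_between x y z : parent x y -> between x z y ->
  [/\ between p x z, between p z y, mdist p z = mdist p x + mdist x z &
      mdist x z + mdist z y = 2^-1].
Proof.
move=> [pxy <-] xzy.
have pxz : between p x z.
  apply/between_sym/(between_transr (between_sym pxy)); exact: between_sym.
split=> //.
apply/between_sym/(between_trans (between_sym pxy)); exact: between_sym.
Qed.

(** By integrality of [gprod], [p, w] either contains [v] or leaves [p, v] no later than [u]. So the
    way from [x] to [w] passes through [v] or [u], each at least 1/2 from [w]. *)
Lemma edge_far u v w x : parent (val u) (val v) ->
  between (val u) x (val v) -> w <> u -> w <> v -> 2^-1 <= mdist x (val w).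
Proof.
move=> uv uxv wu wv; have [pux pxv du _] := parent_between uv uxv.
have dist0 := mdist_ge0 (val u) x.
have [puv duv] := uv.
have /natrP[m mE] := gprod_vertex v w.
have /natrP[n nE] := valP v.
have dvw : 2^-1 <= mdist (val v) (val w) by apply: vertex_dist => /esym.
have duw : 2^-1 <= mdist (val u) (val w) by apply: vertex_dist => /esym.
clear wu wv.
have [le_nm|lt_mn] := leqP n m.
- have pvw : between p (val v) (val w).
    apply/between_gprod/eqP; rewrite eq_le gprod_le nE mE ler_nat //.
  have := between_transr pvw pxv; rewrite /between.
  by have := mdist_ge0 x (val v); lra.
- have {lt_mn} : m%:R + 1 <= n%:R :> R by rewrite natr1 ler_nat.
  rewrite -nE -mE => le1.
  move: (puv) (pxv) => /between_gprod guv /between_gprod.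
  rewrite gprodC => gvx; move: puv; rewrite /between => puv.
  have := metric_triangle (val u) x (val w).
  have [] := gprod_ultrametric fourX p (val u) (val v) (val w);
    have [] := gprod_ultrametric fourX p (val v) x (val w);
    rewrite /gprod in guv gvx le1 *; lra.
Qed.

Lemma edge_sym : symmetric edge.
Proof. by move=> u v; apply/asboolP/asboolP => -[]; tauto. Qed.

Lemma edge_neq u v : edge u v -> u <> v.
Proof. by move=> /asboolP + uv; rewrite uv /parent mdistxx => -[] []; lra. Qed.

(** Extend [p, y] to [p, e] with [e] in [E]. Since [2 * mdist p e] is an integer above [n], the
    segment contains points at distances n/2 and (n+1)/2 from [p], and they enclose [y]. *)
Lemma parent_exists (n : nat) y : n%:R < 2 * mdist p y <= n.+1%:R ->
  exists u v, [/\ parent (val u) (val v), between (val u) y (val v),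
    2 * mdist p (val u) = n%:R, between p (val u) y & between p y (val v)].
Proof.
move=> /andP[ny yn]; have [e Ee pye] := coverE y.
have ye : mdist p y <= mdist p e.
  by move: pye; rewrite /between; have := mdist_ge0 y e; lra.
have ne : n.+1%:R <= 2 * mdist p e.
  have : 2 * mdist p e \is a Num.nat.
    rewrite natrEint mulr_ge0 ?mdist_ge0 // andbT.
    by apply: rpredM; [exact: rpred_nat | exact: int_pE].
  by case/natrP => k kE; move: ye ny; rewrite kE ler_nat -(ltr_nat R); lra.
have nS : n.+1%:R = n%:R + 1 :> R by rewrite natr1.
have n0 : 0 <= n%:R :> R by rewrite ler0n.
have [u0 pue du] : exists2 z, between p z e & mdist p z = n%:R / 2.
  by apply: geodX; lra.
have [v0 pve dv] : exists2 z, between p z e & mdist p z = n.+1%:R / 2.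
  by apply: geodX; lra.
have Vu : vertex u0 by rewrite /vertex du mulrC divfK ?pnatr_eq0.
have Vv : vertex v0 by rewrite /vertex dv mulrC divfK ?pnatr_eq0.
exists (exist _ u0 Vu), (exist _ v0 Vv) => /=.
have := between_dist fourX pue pve; have := between_dist fourX pue pye.
have := between_dist fourX pye pve.
move=> /(_ ltac:(lra)) hyv /(_ ltac:(lra)) huy /(_ ltac:(lra)) huv.
by split; rewrite /parent /between; try split; lra.
Qed.

(* On an edge these hat functions are the barycentric coordinates, because the
   other vertices are at distance at least 1/2. *)
Definition coord x : V -> R := fun w => Num.max 0 (1 - 2 * mdist x (val w)).

Lemma coord_near x w : mdist x (val w) <= 2^-1 ->
  coord x w = 1 - 2 * mdist x (val w).
Proof. by move=> h; rewrite /coord max_r //; lra. Qed.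

Lemma coord_far x w : 2^-1 <= mdist x (val w) -> coord x w = 0.
Proof. by move=> h; rewrite /coord max_l //; lra. Qed.

Lemma coord_gt0 x y w : coord x w = coord y w -> 0 < coord x w ->
  mdist x (val w) = mdist y (val w).
Proof.
move=> e; have := e; rewrite /coord.
by have [_|_] := leP 0 (1 - 2 * mdist x (val w));
  have [_|_] := leP 0 (1 - 2 * mdist y (val w)); lra.
Qed.

Lemma coord_vertex u : cell u u (coord (val u)).
Proof.
split=> [w|w|].
- by rewrite le_max lexx.
- by move=> uw; apply: coord_far; apply: vertex_dist => e; apply: uw; left.
- by rewrite setUid fsbig_set1 coord_near mdistxx ?mulr0 ?subr0 // invr_ge0.
Qed.

Lemma coord_edge u v x : edge u v -> between (val u) x (val v) ->
  [/\ coord x u = 1 - 2 * mdist (val u) x, coord x v = 1 - 2 * mdist x (val v),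
      mdist (val u) x + mdist x (val v) = 2^-1 & cell u v (coord x)].
Proof.
move=> uv uxv; have neq := edge_neq uv.
have sum_d : mdist (val u) x + mdist x (val v) = 2^-1.
  by move/asboolP: uv => -[[_ <-//]|[_]]; rewrite metric_sym uxv.
have [d1 d2] := (mdist_ge0 (val u) x, mdist_ge0 x (val v)).
have cu : coord x u = 1 - 2 * mdist (val u) x.
  by rewrite metric_sym coord_near // metric_sym; lra.
have cv : coord x v = 1 - 2 * mdist x (val v) by rewrite coord_near //; lra.
split=> //; split=> [w|w uvw|].
- by rewrite le_max lexx.
- have [wu wv] : w <> u /\ w <> v by split=> e; apply: uvw; [left | right].
  apply: coord_far; move/asboolP: uv => [uv|vu]; first exact: edge_far uxv _ _.
  by apply: (edge_far vu) => //; exact: between_sym.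
- by rewrite sum_cell // cu cv; lra.
Qed.

Lemma cell_edge u v q : edge u v -> cell u v q ->
  exists2 x, between (val u) x (val v) & coord x = q.
Proof.
move=> uv [q0 qout]; rewrite sum_cell; last exact: edge_neq.
move=> qsum; have [qu qv] := (q0 u, q0 v).
have duv : mdist (val u) (val v) = 2^-1.
  by move/asboolP: uv => -[[_ <-//]|[_]]; rewrite metric_sym.
(* On an edge of length 1/2, the weight of [v] is twice the distance from [u]. *)
have [x uxv ux] : exists2 x,
    between (val u) x (val v) & mdist (val u) x = q v / 2.
  by apply: geodX; rewrite duv; lra.
exists x => //; apply/funext => w.
have [cu cv dd [_ cout _]] := coord_edge uv uxv.
have [->|wu] := pselect (w = u); first by rewrite cu ux; lra.
have [->|wv] := pselect (w = v); first by rewrite cv; lra.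
by rewrite cout ?qout // => -[].
Qed.

Lemma vertex_or_edge x :
  (exists u, val u = x) \/ exists u v, edge u v /\ between (val u) x (val v).
Proof.
have x0 : 0 <= 2 * mdist p x by rewrite mulr_ge0 ?mdist_ge0.
have /andP[le_n lt_n] := Num.Theory.truncn_itv x0.
move: le_n; rewrite le_eqVlt => /predU1P[nx|lt_nx].
  have Vx : vertex x by rewrite /vertex -nx natr_nat.
  by left; exists (exist _ x Vx).
right.
have [|u [v [uv uxv _ _ _]]] :=
  @parent_exists (Num.truncn (2 * mdist p x)) x.
  by rewrite lt_nx ltW.
by exists u, v; split=> //; apply/asboolP; left.
Qed.

Lemma realization_coord x : realization edge (coord x).
Proof.
have [[u <-]|[u [v [uv uxv]]]] := vertex_or_edge x.
- by exists u, u; split; [left | exact: coord_vertex].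
- by exists u, v; split; [right | have [] := coord_edge uv uxv].
Qed.

(** Inside an edge the two positive coordinates determine the distances to both ends; if one
    vanishes, the other is 1 and the point is a vertex. *)
Lemma coord_inj : injective coord.
Proof.
move=> x y xy.
have at_vertex u : coord x u = 1 -> x = y.
  move=> xu; have near1 z : coord z u = 1 -> z = val u.
    move=> zu; apply: mdist_positivity; have := mdist_ge0 z (val u).
    move: zu; rewrite /coord.
    by have [_|_] := leP 0 (1 - 2 * mdist z (val u)); lra.
  have yu : coord y u = 1 by rewrite -xy.
  by rewrite (near1 x xu) (near1 y yu).
have [[u ux]|[u [v [uv uxv]]]] := vertex_or_edge x.
  by apply: (at_vertex u); rewrite -ux coord_near mdistxx ?mulr0 ?subr0.
have [cu cv dd [c0 _ _]] := coord_edge uv uxv.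
have [cu0|cu0] := leP (coord x u) 0.
  by apply: (at_vertex v); have := c0 u; lra.
have [cv0|cv0] := leP (coord x v) 0.
  by apply: (at_vertex u); have := c0 v; lra.
have xu := coord_gt0 (congr1 (@^~ u) xy) cu0.
have xv := coord_gt0 (congr1 (@^~ v) xy) cv0.
apply: (between_unique fourX uxv); last by rewrite !(metric_sym (val u)).
by rewrite /between (metric_sym _ y) -xu -xv metric_sym.
Qed.

Lemma realization_onto q : realization edge q -> exists x, coord x = q.
Proof.
move=> [u [v [[<-|uv] qc]]]; last first.
  by have [x _ xq] := cell_edge uv qc; exists x.
exists (val u); apply/funext => w; have [_ c0 c1] := coord_vertex u.
have [_ q0 q1] := qc.
rewrite setUid fsbig_set1 in c1; rewrite setUid fsbig_set1 in q1.
have [->|wu] := pselect (w = u); first by rewrite c1 q1.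
by rewrite c0 ?q0 // => -[].
Qed.

(** * Comparison of the chain distance with the metric *)

Local Notation half := (fun _ _ : V => 2^-1 : R).

Lemma edge_dist u v x y : edge u v -> between (val u) x (val v) ->
  between (val u) y (val v) -> mdist x y = 2^-1 * `|coord x u - coord y u|.
Proof.
move=> uv uxv uyv; have [-> _ _ _] := coord_edge uv uxv.
have [-> _ _ _] := coord_edge uv uyv.
have [xy|yx] := leP (mdist (val u) x) (mdist (val u) y).
- by rewrite (between_dist fourX uxv uyv xy) ger0_norm; lra.
- by rewrite metric_sym (between_dist fourX uyv uxv (ltW yx)) ler0_norm; lra.
Qed.

Lemma string_ge x y r :
  string edge half (coord x) (coord y) r -> mdist x y <= r.
Proof.
move eqx : (coord x) => qx; move eqy : (coord y) => qy st.
elim: st x y eqx eqy => {qx qy r} [q _ x y <- /coord_inj ->|].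
  by rewrite mdistxx.
move=> q q' q'' u v r uv qc q'c _ IH x y xq yq.
have [x1 ux1v x1q] := cell_edge uv qc; have [x2 ux2v x2q] := cell_edge uv q'c.
have {x1q} xE : x1 = x by apply: coord_inj; rewrite xq.
rewrite xE in ux1v.
have := edge_dist uv ux1v ux2v; rewrite xq x2q => <-.
by have := IH _ _ x2q yq; have := metric_triangle x x2 y; lra.
Qed.

Lemma string_edge u v x y : edge u v -> between (val u) x (val v) ->
  between (val u) y (val v) -> string edge half (coord x) (coord y) (mdist x y).
Proof.
move=> uv uxv uyv; rewrite (edge_dist uv uxv uyv).
have [[_ _ _ cx] [_ _ _ cy]] := (coord_edge uv uxv, coord_edge uv uyv).
exact: (string1 half uv cx cy).
Qed.

(** Descend from [y] towards the root edge by edge, by induction on a bound for its level; the last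
    link stops at [x] inside an edge. *)
Lemma string_down x y : between p x y ->
  string edge half (coord y) (coord x) (mdist y x).
Proof.
have [n] : exists n : nat, 2 * mdist p y <= n%:R.
  exists (Num.bound (2 * mdist p y)); apply/ltW/archi_boundP.
  by rewrite mulr_ge0 ?mdist_ge0.
elim: n y => [|n IH] y le_yn pxy.
  have [y0 x0] := (mdist_ge0 p y, mdist_ge0 p x).
  have xy : mdist x y = 0.
    by move: pxy (mdist_ge0 x y); rewrite /between; lra.
  rewrite (mdist_positivity _ _ xy) mdistxx; apply: string_nil.
  exact: realization_coord.
have [|lt_ny] := leP (2 * mdist p y) n%:R; first by move=> /IH; exact.
have [|u [v [uv uyv du puy pyv]]] := @parent_exists n y; first by rewrite lt_ny.
have edge_uv : edge u v by apply/asboolP; left.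
have [ux|xu] := leP (mdist p (val u)) (mdist p x).
- apply: (string_edge edge_uv uyv).
  have pux : between p (val u) x.
    by rewrite /between (between_dist fourX puy pxy ux); lra.
  exact: between_transr (between_trans pyv pxy) pux.
- have pxu : between p x (val u).
    by rewrite /between (between_dist fourX pxy puy (ltW xu)); lra.
  have -> : mdist y x = mdist y (val u) + mdist (val u) x.
    move: pxu puy pxy; rewrite /between (metric_sym y x) (metric_sym y (val u)).
    by rewrite (metric_sym (val u) x); lra.
  apply: string_cat (IH _ _ pxu); last by rewrite du.
  by apply: (string_edge edge_uv uyv); exact: betweenl.
Qed.

(** Descend from [x] to the median [m] of [p], [x], [y], then climb to [y]. *)
Lemma string_dist x y : string edge half (coord x) (coord y) (mdist x y).
Proof.
have [m pmx dm] : exists2 m, between p m x & mdist p m = gprod p x y / 2.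
  by apply: geodX; have := gprod_ge0 p x y; have := gprod_le p x y; lra.
have pmy : between p m y.
  have := gprod_le p m y; move/between_gprod: (pmx) => gmx le_m.
  apply/between_gprod/eqP; rewrite eq_le le_m /=.
  by have [] := gprod_ultrametric fourX p m x y; lra.
have -> : mdist x y = mdist x m + mdist m y.
  by move: pmx pmy dm; rewrite /between /gprod (metric_sym x m); lra.
apply: string_cat (string_down pmx) _; rewrite metric_sym.
exact/string_sym/string_down.
Qed.

Lemma realization_dist_coord x y :
  realization_dist edge half (coord x) (coord y) = mdist x y.
Proof.
apply/eqP; rewrite eq_le; apply/andP; split.
- apply: ge_inf; last exact: string_dist.
  by exists (mdist x y) => r; exact: string_ge.
- apply: lb_le_inf; first by exists (mdist x y); exact: string_dist.
  by move=> r; exact: string_ge.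
Qed.

(** * The graph of vertices is a tree *)

Lemma parent_unique x y z : parent x z -> parent y z -> x = y.
Proof.
move=> [pxz xz] [pyz yz]; apply: (between_unique fourX pxz pyz).
by move: pxz pyz; rewrite /between xz yz; lra.
Qed.

Lemma root_vertex : vertex p.
Proof. by rewrite /vertex mdistxx mulr0. Qed.

Definition root_path u :=
  exists2 s, path edge u s & last u s = exist _ p root_vertex.

Lemma root_pathP u : root_path u.
Proof.
have /natrP[n] := valP u; elim: n u => [|n IH] u un.
  exists [::] => //=; apply: val_inj; apply/esym/mdist_positivity.
  by move/eqP: un; rewrite mulf_eq0 pnatr_eq0 => /eqP.
have [|v [w [vw vuw vn pvu puw]]] := @parent_exists n (val u).
  by rewrite un lexx ltr_nat ltnSn.
have vu : edge u v.
  apply/asboolP; right; split=> //.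
  by move: pvu; rewrite /between; move: un; rewrite -(natr1 n); lra.
have [s vs sE] := IH v vn; exists (v :: s) => //=.
by rewrite vu.
Qed.

Lemma combinatorial_tree_edge : combinatorial_tree edge.
Proof.
split; first exact: edge_sym.
- by move=> u; apply/negP => /edge_neq.
- by exists; exists p; exact: root_vertex.
- move=> u v; have [s us sE] := root_pathP u; have [t vt tE] := root_pathP v.
  exists (s ++ rev (belast v t)); split.
  + rewrite cat_path us sE -tE rev_path.
    by under eq_path do rewrite edge_sym.
  + rewrite last_cat sE -tE; case: t {vt tE} => //= a t.
    by rewrite rev_cons last_rcons.
(* On a cycle, both neighbours of a vertex farthest from the root are its parent, hence equal. After
   rotating that vertex to the front they are the first and last of the rest, distinct as the size
   exceeds 2. *)
- move=> c /andP[cyc uniq_c]; rewrite leqNgt; apply/negP => size_c.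
  have [|v vc vmax] := @seq_max _ _ (fun v => mdist p (val v)) c.
    by case: c size_c {cyc uniq_c}.
  have up w : w \in c -> edge v w -> parent (val w) (val v).
    move=> wc /asboolP[[]|//]; rewrite /between => pvw vw.
    by have := vmax w wc; lra.
  case: (rot_to vc) => i s rotE.
  have size_s : (2 < size (v :: s))%N by rewrite -rotE size_rot.
  have mem_s w : w \in s -> w \in c.
    by move=> ws; rewrite -(mem_rot i) rotE inE ws orbT.
  have : uniq (v :: s) by rewrite -rotE rot_uniq.
  have : cycle edge (v :: s) by rewrite -rotE rot_cycle.
  case: s size_s mem_s {rotE} => // a s; case/lastP: s => // s z _ mem_s.
  rewrite /= rcons_path last_rcons => /andP[va /andP[_ zv]].
  move=> /= /andP[_ /andP[+ _]]; rewrite mem_rcons inE negb_or.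
  move=> /andP[/eqP az _].
  apply: az; apply: val_inj; apply: parent_unique (up z _ _).
  + by apply: up => //; apply: mem_s; rewrite inE eqxx.
  + by apply: mem_s; rewrite inE mem_rcons inE eqxx orbT.
  + by rewrite edge_sym.
Qed.

Lemma half_integral_simplicial : is_simplicial_tree X.
Proof.
exists V, edge, half; split=> //; first exact: combinatorial_tree_edge.
  by exists 2^-1 => //; rewrite invr_gt0.
(* [f] inverts [coord]; outside the realization it takes the default value [p]. *)
have [f fK] : exists f : (V -> R) -> X, forall x, f (coord x) = x.
  exists (fun q => xget p [set x | coord x = q]) => x.
  by apply: xget_subset1 => // y z /= <- /coord_inj.
have coordK q : realization edge q -> coord (f q) = q.
  by move=> /realization_onto[x <-]; rewrite fK.
exists f; split.
- split=> //.
  + by move=> q q'; rewrite !inE => /coordK <- /coordK <-; rewrite !fK => ->.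
  + by move=> x _; exists (coord x); [exact: realization_coord | exact: fK].
- by move=> q q' /coordK {2}<- /coordK {2}<-; rewrite realization_dist_coord.
Qed.

End HalfIntegralTree.

(** * The segments from the base point to its orbit *)

Lemma orbit_segments_cover (R : realType) (X : metricType R) (G : groupType)
    (act : G -> X -> X) (p x : X) : is_Rtree [set: X] ->
  isometric_action act -> minimal_action act ->
  exists k, between p x (act k p).
Proof.
move=> treeX isoG minG; have fourX := Rtree_four_point treeX.
pose Y : set X := [set y | exists k, between p y (act k p)].
suff YT : Y = [set: X] by rewrite -[exists k, _]/(Y x) YT.
apply: minG.
- split; first by exists p, 1%g; exact: betweenl.
  apply: convex_Rtree => // y z w [k pyk] [l pwl].
  move=> /(between_split fourX p) [ypz|pzw].
  + by exists k; apply: between_trans pyk _; exact: between_sym.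
  + by exists l; exact: between_trans pwl pzw.
(* The translate of [p, kp] is [gp, gkp], which is contained in the union of [p, gp] and
   [p, gkp]. *)
- move=> g y [k]; rewrite (act_between isoG g) -actM // => gk.
  have [gy|yg] := between_split fourX p gk.
  + by exists g; exact: between_sym.
  + by exists (g * k)%g.
Qed.

Theorem proposition2p7 (R : realType) (Gamma : metricType R) (G : groupType)
    (act : G -> Gamma -> Gamma)
    (fgG : finitely_generated G)
    (treeGamma : is_Rtree [set: Gamma]%classic)
    (isoG : isometric_action act)
    (minG : minimal_action act)
    (irrG : irreducible_action act)
    (intG : forall g : G, translation_length (act g) \is a Num.int) :
  is_simplicial_tree Gamma.
Proof.
have [geodX fourX] := (Rtree_geodesic treeGamma, Rtree_four_point treeGamma).
have [p int_p] := integral_orbit_exists geodX fourX isoG irrG intG.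
apply: (half_integral_simplicial (p := p) (E := range (act^~ p))) => //.
- move=> x; have [k pxk] := orbit_segments_cover p x treeGamma isoG minG.
  by exists (act k p) => //; exists k.
- by move=> _ [k _ <-].
- move=> _ _ [k _ <-] [l _ <-].
  by rewrite -(act_isometry isoG k^-1%g) (actVK isoG) -(actM isoG).
Qed.
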